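(* Let $C=\{1,\ldots,\ell\}$, $A_k\in\mathbb{S}^\ell$ $(k=0,1,\ldots,m)$, $D\subseteq\{(i,i):1\le i\le\ell\}$, $\delta\in\mathbb{R}^m$ and $U\in\mathbb{S}^\ell(D)$. Consider the SDP $$ \inf\Big\{\langle A_0,Y\rangle:\ Y\in\mathbb{S}^\ell_+,\ \langle A_k,Y\rangle\trianglelefteq_k\delta_k\ (k=1,\ldots,m),\ [Y]_{ii}=U_{ii}\ ((i,i)\in D)\Big\}.\qquad(S) $$ Assume: (A) All the matrices $A_k$ $(k=0,\ldots,m)$ share a common block-diagonal structure: there is a partition $\{F_q:q=1,\ldots,\hat q\}$ of $C$, with $i<j$ whenever $i\in F_q$, $j\in F_r$ and $q<r$, such that $A_k=\mathrm{diag}(B^1_k,\ldots,B^{\hat q}_k)$ with $B^q_k\in\mathbb{S}^{F_q}$ $(q=1,\ldots,\hat q,\ k=0,\ldots,m)$. Let $D_q=D\cap(F_q\times F_q)$ $(q=1,\ldots,\hat q)$, and consider the separable SDP, equivalent to $(S)$ under (A), $$ \inf\Big\{\sum_{q=1}^{\hat q}\langle B^q_0,W^q\rangle:\ W^q\in\mathbb{S}^{F_q}_+\ (q=1,\ldots,\hat q),\ \sum_{q=1}^{\hat q}\langle B^q_k,W^q\rangle\trianglelefteq_k\delta_k\ (k=1,\ldots,m),\ [W^q]_{ii}=U_{ii}\ ((i,i)\in D_q,\ q=1,\ldots,\hat q)\Big\}.\qquad(S') $$ Let $\mu$ be the number of elements in $\{(i,i)\in D: U_{ii}>0\}$, and assume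 further: (B) For every optimal solution $(W^1,\ldots,W^{\hat q})$ of $(S')$, at least $m+\mu-1$ members of the following collection (of $\hat q$ matrices and $m$ real numbers) are nonzero: $$ \{W^q:q=1,\ldots,\hat q\}\ \cup\ \Big\{\delta_k-\sum_{q=1}^{\hat q}\langle B^q_k,W^q\rangle:\ k=1,\ldots,m\Big\}. $$ Then the SDP $(S)$ is exact.
   Context: $\mathbb{S}^\ell$ is the space of real symmetric $\ell\times\ell$ matrices with inner product $\langle A,B\rangle=\sum_{i,j}[A]_{ij}[B]_{ij}$, and $\mathbb{S}^\ell_+$ is its cone of positive semidefinite matrices; for $F\subseteq C$, $\mathbb{S}^F$ and $\mathbb{S}^F_+$ are the analogous objects for matrices with rows and columns indexed by $F$. For each $k=1,\ldots,m$, $\trianglelefteq_k$ is a fixed relation, one of $\le$, $=$, $\ge$. For a set $D$ of diagonal positions, $\mathbb{S}^\ell(D)$ is the set of partial matrices $U$ with real entries $U_{ii}$ specified for $(i,i)\in D$ (other entries unspecified). The collection in (B) is indexed: its members are counted by the indices $q$ and $k$. The SDP $(S)$ is called exact if, whenever it has an optimal solution, it has an optimal solution $Y$ with $\mathrm{rank}(Y)\le1$. *)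

(* Defs.v *)
From mathcomp Require Import all_boot all_order all_algebra.
From mathcomp Require Import reals.

Set Implicit Arguments.
Unset Strict Implicit.
Unset Printing Implicit Defensive.

Import Order.TTheory GRing.Theory Num.Theory.
Local Open Scope ring_scope.

Definition mxdot (R : realType) (n : nat) (A B : 'M[R]_n) : R :=
  \sum_i \sum_j A i j * B i j.

Definition psd (R : realType) (n : nat) (A : 'M[R]_n) : Prop :=
  A \is symmetricmx /\ forall x : 'cV[R]_n, 0 <= (x^T *m A *m x) 0 0.

Variant constr_rel := RelLe | RelEq | RelGe.

Definition constr_holds (R : realType) (c : constr_rel) (x y : R) : Prop :=
  match c with
  | RelLe => x <= y
  | RelEq => x = y
  | RelGe => x >= y
  end.

Definition optimal (R : realType) (T : Type) (feas : T -> Prop) (obj : T -> R)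
    (x : T) : Prop :=
  feas x /\ forall y, feas y -> obj x <= obj y.

(* The constraint matrices are indexed by 'I_m.+1: the objective
   A_0 is A ord0, and A_k, for k = 1, ..., m, is A (lift ord0 k) with k : 'I_m.
   A partial matrix U with entries specified on D is encoded by a total matrix
   whose entries are read only at positions of D. *)

Definition sdp_feasible (R : realType) (l m : nat) (A : 'I_m.+1 -> 'M[R]_l)
    (rels : 'I_m -> constr_rel) (delta : 'I_m -> R)
    (D : {set 'I_l * 'I_l}) (U : 'M[R]_l) (Y : 'M[R]_l) : Prop :=
  [/\ psd Y,
      forall k, constr_holds (rels k) (mxdot (A (lift ord0 k)) Y) (delta k)
    & forall i, (i, i) \in D -> Y i i = U i i].

Definition sdp_optimal (R : realType) (l m : nat) (A : 'I_m.+1 -> 'M[R]_l)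
    (rels : 'I_m -> constr_rel) (delta : 'I_m -> R)
    (D : {set 'I_l * 'I_l}) (U : 'M[R]_l) : 'M[R]_l -> Prop :=
  optimal (sdp_feasible A rels delta D U) (mxdot (A ord0)).

Definition sdp_exact (R : realType) (l m : nat) (A : 'I_m.+1 -> 'M[R]_l)
    (rels : 'I_m -> constr_rel) (delta : 'I_m -> R)
    (D : {set 'I_l * 'I_l}) (U : 'M[R]_l) : Prop :=
  (exists Y, sdp_optimal A rels delta D U Y) ->
  exists2 Y, sdp_optimal A rels delta D U Y & (\rank Y <= 1)%N.

Definition ordered_partition (l qh : nat) (F : 'I_qh -> {set 'I_l}) : Prop :=
  [/\ injective F,
      partition [set F q | q : 'I_qh] [set: 'I_l]
    & forall (q r : 'I_qh) (i j : 'I_l),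
        i \in F q -> j \in F r -> (q < r)%N -> (i < j)%N].

(* A matrix with rows and columns indexed by a set F is an element of
   'M_#|F|, its index a : 'I_#|F| standing for enum_val a, the a-th smallest
   element of F. *)

Definition block_diag (R : realType) (l qh : nat) (F : 'I_qh -> {set 'I_l})
    (B : forall q, 'M[R]_#|F q|) : 'M[R]_l :=
  \sum_q \sum_(a < #|F q|) \sum_(b < #|F q|)
    B q a b *: delta_mx (enum_val a) (enum_val b).

Lemma block_diagE (R : realType) (l qh : nat) (F : 'I_qh -> {set 'I_l})
    (B : forall q, 'M[R]_#|F q|) (q : 'I_qh) (a b : 'I_#|F q|) :
  ordered_partition F ->
  block_diag B (enum_val a) (enum_val b) = B q a b.
Proof.
case=> Finj /and3P[_ /trivIsetP tF _] _.
rewrite /block_diag summxE (bigD1 q) //= [X in _ + X]big1 ?addr0.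
  rewrite summxE (bigD1 a) //= [X in _ + X]big1 ?addr0.
    rewrite summxE (bigD1 b) //= [X in _ + X]big1 ?addr0.
      by rewrite !mxE !eqxx mulr1.
    move=> c neq_cb; rewrite !mxE !(inj_eq enum_val_inj) (eq_sym b).
    by rewrite (negPf neq_cb) andbF mulr0.
  move=> c neq_ca; rewrite summxE big1 // => d _.
  by rewrite !mxE !(inj_eq enum_val_inj) (eq_sym a) (negPf neq_ca) mulr0.
move=> r neq_rq; rewrite summxE big1 // => c _; rewrite summxE big1 // => d _.
rewrite !mxE; case: eqP => [eq_ac|]; last by rewrite mulr0.
have /disjointFr/(_ (enum_valP c)) : [disjoint F r & F q].
  by apply: tF; rewrite ?imset_f // (inj_eq Finj).
by rewrite -eq_ac enum_valP.
Qed.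

Lemma block_diag_off (R : realType) (l qh : nat) (F : 'I_qh -> {set 'I_l})
    (B : forall q, 'M[R]_#|F q|) (q r : 'I_qh) (i j : 'I_l) :
  ordered_partition F -> i \in F q -> j \in F r -> q != r ->
  block_diag B i j = 0.
Proof.
case=> Finj /and3P[_ /trivIsetP tF _] _ iq jr neq_qr.
have sameF (s t : 'I_qh) x : x \in F s -> x \in F t -> s = t.
  move=> xs xt; apply/eqP; apply: contraTT xt => neq_st.
  have /disjointFr/(_ xs) -> // : [disjoint F s & F t].
  by apply: tF; rewrite ?imset_f // (inj_eq Finj).
rewrite /block_diag summxE big1 // => s _; rewrite summxE big1 // => c _.
rewrite summxE big1 // => d _; rewrite !mxE.
case: (i =P _) => [ic|]; last by rewrite mulr0.
case: (j =P _) => [jd|]; last by rewrite mulr0.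
have qs : q = s by apply: sameF iq _; rewrite ic enum_valP.
have rs : r = s by apply: sameF jr _; rewrite jd enum_valP.
by rewrite qs rs eqxx in neq_qr.
Qed.

Definition diag_block (l qh : nat) (F : 'I_qh -> {set 'I_l})
    (D : {set 'I_l * 'I_l}) (q : 'I_qh) : {set 'I_l * 'I_l} :=
  D :&: setX (F q) (F q).

Definition sep_dot (R : realType) (l qh : nat) (F : 'I_qh -> {set 'I_l})
    (B W : forall q, 'M[R]_#|F q|) : R :=
  \sum_q mxdot (B q) (W q).

Definition sep_feasible (R : realType) (l m qh : nat)
    (F : 'I_qh -> {set 'I_l}) (B : 'I_m.+1 -> forall q, 'M[R]_#|F q|)
    (rels : 'I_m -> constr_rel) (delta : 'I_m -> R)
    (D : {set 'I_l * 'I_l}) (U : 'M[R]_l)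
    (W : forall q, 'M[R]_#|F q|) : Prop :=
  [/\ forall q, psd (W q),
      forall k, constr_holds (rels k) (sep_dot (B (lift ord0 k)) W) (delta k)
    & forall q (a : 'I_#|F q|),
        (enum_val a, enum_val a) \in diag_block F D q ->
        W q a a = U (enum_val a) (enum_val a)].

Definition sep_optimal (R : realType) (l m qh : nat)
    (F : 'I_qh -> {set 'I_l}) (B : 'I_m.+1 -> forall q, 'M[R]_#|F q|)
    (rels : 'I_m -> constr_rel) (delta : 'I_m -> R)
    (D : {set 'I_l * 'I_l}) (U : 'M[R]_l) :
    (forall q, 'M[R]_#|F q|) -> Prop :=
  optimal (sep_feasible B rels delta D U) (sep_dot (B ord0)).

Definition num_nonzero (R : realType) (l m qh : nat)
    (F : 'I_qh -> {set 'I_l}) (B : 'I_m.+1 -> forall q, 'M[R]_#|F q|)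
    (delta : 'I_m -> R) (W : forall q, 'M[R]_#|F q|) : nat :=
  (#|[set q | W q != 0%R]|
  + #|[set k : 'I_m | (delta k - sep_dot (B (lift ord0 k)) W != 0)%R]|)%N.

Definition num_pos_diag (R : realType) (l : nat) (D : {set 'I_l * 'I_l})
    (U : 'M[R]_l) : nat :=
  #|[set p in D | 0 < U p.1 p.2]|.

(* Main.v *)
Require Import Defs.
From mathcomp Require Import all_boot all_order all_algebra.
From mathcomp Require Import reals.
From mathcomp Require Import ring lra.

Set Implicit Arguments.
Unset Strict Implicit.
Unset Printing Implicit Defensive.

Import Order.TTheory GRing.Theory Num.Theory.
Local Open Scope ring_scope.

(** Write an optimal solution as a sum of rank-one atoms [v_j v_j^T], each [v_j]
supported in a single block [F_q]; this replaces [Y] by its block-diagonal part,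
which changes neither the constraints nor the objective, since both only read
the blocks of [Y]. Among all optimal solutions written in this way, take one
for which the number of nonzero atoms plus the number of nonzero slacks is
minimal. The claim is that no block then carries two nonzero atoms.

Suppose that [v_1] and [v_2] lie in the same block. Consider the directions
  [Z = sum_j x_j v_j v_j^T + b (v_1 v_2^T + v_2 v_1^T)]
together with a relative change [y_k] of every nonzero slack. The free
parameters are one per nonzero atom, one per nonzero slack, and [b]. As one
block has two atoms, hypothesis (B) gives at least [m + mu + 1] parameters. The
homogeneous equations are the [m] slack equations and the [mu] equations
[Z_ii = 0] at the positive prescribed diagonal entries (at a zero entry every
atom vanishes anyway), so a nonzero direction exists ([exists_kernel]). This is
the count of Pataki's rank bound for extreme points, where a block of rank [r]
contributes [r (r + 1) / 2] parameters; keeping a single off-diagonal parameter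
[b] is enough here.

The 2 x 2 symmetric matrix with diagonal [x_1], [x_2] and off-diagonal entry [b]
is diagonalized by a rotation of the pair [v_1, v_2], which does not change
[v_1 v_1^T + v_2 v_2^T] ([diagonalize_pair]). So one may assume that [Z] only
rescales atoms: [Z = sum_j lam_j u_j u_j^T]. Scale the direction so that all the
coefficients [lam_j], [y_k] are at most 1 in absolute value and one of them is
-1. Then both [Y + Z] and [Y - Z] are feasible, so optimality of [Y] makes [Z]
orthogonal to the objective and [Y + Z] is optimal too; the coefficient -1
kills an atom or a slack, against minimality ([exists_fewer_active]).

Finally, if each block carries at most one nonzero atom, let [w] be the sum of
all the [v_j]. The matrix [w w^T] has the same blocks as [sum_j v_j v_j^T], so
it is an optimal solution of rank at most one ([rank1_optimal]). *)

(** * The trace inner product *)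

Lemma mxdotDr (R : realType) (n : nat) (A B C : 'M[R]_n) :
  mxdot A (B + C) = mxdot A B + mxdot A C.
Proof.
rewrite /mxdot -big_split; apply: eq_bigr => i _ /=.
by rewrite -big_split; apply: eq_bigr => j _ /=; rewrite mxE mulrDr.
Qed.

Lemma mxdotZr (R : realType) (n : nat) (A B : 'M[R]_n) (c : R) :
  mxdot A (c *: B) = c * mxdot A B.
Proof.
rewrite /mxdot mulr_sumr; apply: eq_bigr => i _.
by rewrite mulr_sumr; apply: eq_bigr => j _; rewrite mxE mulrCA.
Qed.

Lemma mxdot0r (R : realType) (n : nat) (A : 'M[R]_n) : mxdot A 0 = 0.
Proof. by rewrite -(scale0r 0) mxdotZr mul0r. Qed.

Lemma mxdotNr (R : realType) (n : nat) (A B : 'M[R]_n) :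
  mxdot A (- B) = - mxdot A B.
Proof. by rewrite -scaleN1r mxdotZr mulN1r. Qed.

Lemma mxdot_sumr (R : realType) (n : nat) (A : 'M[R]_n) (I : Type)
    (s : seq I) (P : pred I) (E : I -> 'M[R]_n) :
  mxdot A (\sum_(i <- s | P i) E i) = \sum_(i <- s | P i) mxdot A (E i).
Proof. exact: (big_morph _ (@mxdotDr _ _ A) (@mxdot0r _ _ A)). Qed.

Lemma mxdotC (R : realType) (n : nat) (A B : 'M[R]_n) : mxdot A B = mxdot B A.
Proof.
by apply: eq_bigr => i _; apply: eq_bigr => j _; rewrite mulrC.
Qed.

Lemma mxdot_delta (R : realType) (n : nat) (Y : 'M[R]_n) (i j : 'I_n) :
  mxdot Y (delta_mx i j) = Y i j.
Proof.
rewrite /mxdot (bigD1 i) //= [X in _ + X]big1 => [|i' ni]; last first.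
  by apply: big1 => j' _; rewrite mxE (negPf ni) mulr0.
rewrite addr0 (bigD1 j) //= big1 => [|j' nj]; last first.
  by rewrite mxE (negPf nj) andbF mulr0.
by rewrite addr0 mxE !eqxx mulr1.
Qed.

Lemma symmetricmxP (R : realType) (n : nat) (A : 'M[R]_n) :
  reflect (A^T = A) (A \is symmetricmx).
Proof.
by rewrite is_hermitianmxE expr0 scale1r map_mx_id // eq_sym; exact: eqP.
Qed.

Lemma quad_mxdot (R : realType) (n : nat) (A : 'M[R]_n) (x : 'cV[R]_n) :
  (x^T *m A *m x) 0 0 = mxdot A (x *m x^T).
Proof.
rewrite mxE [RHS]exchange_big /=; apply: eq_bigr => j _.
rewrite mxE mulr_suml; apply: eq_bigr => i _.
by rewrite !mxE big_ord1 !mxE mulrCA mulrA.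
Qed.

(** * Gram sums and positive semidefinite matrices *)

Definition gram (R : realType) (l : nat) (J : finType) (v : J -> 'cV[R]_l) :
  'M[R]_l := \sum_j v j *m (v j)^T.

Lemma outerE (R : realType) (l : nat) (x y : 'cV[R]_l) (i k : 'I_l) :
  (x *m y^T) i k = x i 0 * y k 0.
Proof. by rewrite mxE big_ord1 mxE. Qed.

Lemma gramE (R : realType) (l : nat) (J : finType) (v : J -> 'cV[R]_l)
    (i k : 'I_l) :
  gram v i k = \sum_j v j i 0 * v j k 0.
Proof. by rewrite summxE; apply: eq_bigr => j _; rewrite outerE. Qed.

Lemma mxdot_outer (R : realType) (n : nat) (x y : 'cV[R]_n) :
  mxdot (x *m x^T) (y *m y^T) = (\sum_a x a 0 * y a 0) ^+ 2.
Proof.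
rewrite expr2 mulr_suml; apply: eq_bigr => a _; rewrite mulr_sumr.
by apply: eq_bigr => b _; rewrite !outerE; ring.
Qed.

Lemma psd_gram (R : realType) (l : nat) (J : finType) (v : J -> 'cV[R]_l) :
  psd (gram v).
Proof.
split=> [|x].
  apply/symmetricmxP/matrixP => i k; rewrite mxE !gramE.
  by apply: eq_bigr => j _; rewrite mulrC.
rewrite quad_mxdot mxdotC mxdot_sumr sumr_ge0 // => j _.
by rewrite mxdot_outer sqr_ge0.
Qed.

Lemma mxdot_outerD (R : realType) (n : nat) (Y : 'M[R]_n) (x y : 'cV[R]_n)
    (c : R) :
  Y^T = Y ->
  mxdot Y ((x + c *: y) *m (x + c *: y)^T) =
  mxdot Y (x *m x^T) + c *+ 2 * mxdot Y (x *m y^T) + c ^+ 2 * mxdot Y (y *m y^T).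
Proof.
move=> symY.
have dotT Z : mxdot Y Z^T = mxdot Y Z.
  rewrite -{1}symY /mxdot exchange_big /=; apply: eq_bigr => j _.
  by apply: eq_bigr => i _; rewrite !mxE.
rewrite linearD linearZ /= mulmxDl !mulmxDr -!scalemxAl -!scalemxAr.
rewrite !(mxdotDr, mxdotZr) -[in mxdot Y (y *m x^T)]dotT trmx_mul trmxK.
by ring.
Qed.

Lemma mxdot_outer_delta (R : realType) (n : nat) (Y : 'M[R]_n) (x : 'cV[R]_n)
    (i : 'I_n) :
  mxdot Y (x *m (delta_mx i 0)^T) = \sum_a Y a i * x a 0.
Proof.
apply: eq_bigr => a _; rewrite (bigD1 i) //= big1 => [|b nb].
  by rewrite addr0 outerE mxE !eqxx mulr1.
by rewrite outerE mxE (negPf nb) !mulr0.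
Qed.

Lemma mxdot_delta_outer (R : realType) (n : nat) (Y : 'M[R]_n) (i k : 'I_n) :
  mxdot Y (delta_mx i 0 *m (delta_mx k 0 : 'cV_n)^T) = Y i k.
Proof. by rewrite trmx_delta mul_delta_mx mxdot_delta. Qed.

Lemma psd_diag_ge0 (R : realType) (n : nat) (Y : 'M[R]_n) (i : 'I_n) :
  psd Y -> 0 <= Y i i.
Proof. by case=> _ /(_ (delta_mx i 0)); rewrite quad_mxdot mxdot_delta_outer. Qed.

(** The form at [e_i + e_k] and at [e_i - e_k] is [2 Y_ik] and [- 2 Y_ik], so
[Y_ik] vanishes. *)
Lemma psd_diag0 (R : realType) (n : nat) (Y : 'M[R]_n) :
  psd Y -> (forall i, Y i i = 0) -> Y = 0.
Proof.
case=> /symmetricmxP symY posY d0; apply/matrixP => i k; rewrite [RHS]mxE.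
have pos c := posY (delta_mx i 0 + c *: delta_mx k 0).
move: (pos 1) (pos (-1)); rewrite !quad_mxdot !mxdot_outerD // !mxdot_delta_outer.
by rewrite !d0; lra.
Qed.

(** One step of a Cholesky factorization: the new form at [x] is the old form at
[x - (g / Y_ii) e_i], where [g = (Y x)_i]. *)
Lemma psd_deflate (R : realType) (n : nat) (Y : 'M[R]_n) (i : 'I_n) :
  psd Y -> Y i i != 0 -> psd (Y - (Y i i)^-1 *: (col i Y *m (col i Y)^T)).
Proof.
case=> /symmetricmxP symY posY nYi; split=> [|x].
  by apply/symmetricmxP; rewrite linearB linearZ /= trmx_mul trmxK symY.
pose g := \sum_a Y a i * x a 0.
move: (posY (x + (- (g / Y i i)) *: delta_mx i 0)).
rewrite !quad_mxdot mxdot_outerD // mxdot_delta_outer mxdot_outer_delta -/g.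
rewrite [mxdot (_ - _) _]mxdotC mxdotDr mxdotNr mxdotZr ![mxdot (x *m _) _]mxdotC.
rewrite mxdot_outer; under [X in _ -> _ <= _ - _ * X ^+ 2]eq_bigr do rewrite mxE.
rewrite -/g; congr (_ <= _); field.
exact: nYi.
Qed.

(** Deflation clears the diagonal entry [Y_ii] and keeps the zero ones at zero,
so the number of nonzero diagonal entries decreases until [psd_diag0] applies. *)
Lemma psd_gramP (R : realType) (n : nat) (Y : 'M[R]_n) :
  psd Y -> exists N (v : 'I_N -> 'cV[R]_n), Y = gram v.
Proof.
move=> psdY.
suff [s ->] : exists s : seq 'cV[R]_n, Y = \sum_(v <- s) v *m v^T.
  exists (size s), (fun i => nth 0 s i).
  by rewrite (big_nth 0) big_mkord.
have [d] := ubnP #|[set i | Y i i != 0]|.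
elim: d Y psdY => // d IH Y psdY ltd.
have [i Yi | Y0] := pickP [pred i | Y i i != 0]; last first.
  exists [::]; rewrite big_nil; apply: psd_diag0 => // i.
  by apply/eqP; rewrite -[_ == _]negbK; apply/negbT/Y0.
have psdY' := psd_deflate psdY Yi.
have [|s eqY] := IH _ psdY'.
  rewrite -ltnS; apply: leq_trans ltd; rewrite ltnS; apply: proper_card.
  apply/properP; split; last first.
    exists i; rewrite !inE // negbK !mxE big_ord1 !mxE.
    by rewrite mulrA mulVf // mul1r subrr.
  apply/subsetP => k; rewrite !inE; apply: contraNneq => Yk.
  have := psd_diag_ge0 k psdY'; rewrite !mxE big_ord1 !mxE Yk sub0r oppr_ge0.
  move=> le0; rewrite oppr_eq0 eq_le le0 mulr_ge0 ?sqr_ge0 //.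
  by rewrite invr_ge0; apply: psd_diag_ge0.
exists ((Num.sqrt (Y i i))^-1 *: col i Y :: s).
rewrite big_cons -eqY linearZ /= -scalemxAl -scalemxAr scalerA -invfM.
by rewrite -expr2 sqr_sqrtr ?psd_diag_ge0 // addrC subrK.
Qed.

(** * Diagonal blocks *)

Definition blocks (R : realType) (l qh : nat) (F : 'I_qh -> {set 'I_l})
    (Y : 'M[R]_l) (q : 'I_qh) : 'M[R]_#|F q| :=
  mxsub (@enum_val _ (F q)) (@enum_val _ (F q)) Y.

Lemma mxdot_block_diag (R : realType) (l qh : nat) (F : 'I_qh -> {set 'I_l})
    (B : forall q, 'M[R]_#|F q|) (Y : 'M[R]_l) :
  mxdot (block_diag B) Y = sep_dot B (blocks F Y).
Proof.
rewrite mxdotC mxdot_sumr; apply: eq_bigr => q _.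
rewrite mxdot_sumr; apply: eq_bigr => a _.
rewrite mxdot_sumr; apply: eq_bigr => b _.
by rewrite mxdotZr mxdot_delta mxE.
Qed.

Lemma blocks_block_diag (R : realType) (l qh : nat) (F : 'I_qh -> {set 'I_l})
    (W : forall q, 'M[R]_#|F q|) (q : 'I_qh) :
  ordered_partition F -> blocks F (block_diag W) q = W q.
Proof. by move=> hF; apply/matrixP => a b; rewrite mxE block_diagE. Qed.

Lemma psd_blocks (R : realType) (l qh : nat) (F : 'I_qh -> {set 'I_l})
    (Y : 'M[R]_l) (q : 'I_qh) :
  psd Y -> psd (blocks F Y q).
Proof.
move=> /psd_gramP[N [v ->]].
suff -> : blocks F (gram v) q = gram (fun j => rowsub (@enum_val _ (F q)) (v j)).
  exact: psd_gram.
apply/matrixP => a b; rewrite mxE !gramE.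
by apply: eq_bigr => j _; rewrite !mxE.
Qed.

(** The form of [block_diag W] at [x] is the sum of the forms of the [W q] at the
restrictions of [x]. *)
Lemma psd_block_diag (R : realType) (l qh : nat) (F : 'I_qh -> {set 'I_l})
    (W : forall q, 'M[R]_#|F q|) :
  (forall q, psd (W q)) -> psd (block_diag W).
Proof.
move=> psdW; split=> [|x].
  apply/symmetricmxP; rewrite /block_diag raddf_sum; apply: eq_bigr => q _ /=.
  rewrite raddf_sum [RHS]exchange_big /=; apply: eq_bigr => a _.
  rewrite raddf_sum /=; apply: eq_bigr => b _.
  rewrite linearZ /= trmx_delta; congr (_ *: _).
  by have /symmetricmxP symW := (psdW q).1; rewrite -[in LHS]symW mxE.
rewrite quad_mxdot mxdot_block_diag sumr_ge0 // => q _.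
have -> : blocks F (x *m x^T) q =
    rowsub (@enum_val _ (F q)) x *m (rowsub (@enum_val _ (F q)) x)^T.
  by apply/matrixP => a b; rewrite mxE !outerE !mxE.
by rewrite -quad_mxdot; case: (psdW q).
Qed.

(** * Three auxiliary facts: linear systems, scaling, 2 x 2 matrices *)

(** The index sets are subsets [P] and [Q] of ambient finite types, so that the
solution is directly a function on the ambient type, null outside [P]. *)
Lemma exists_kernel (K : fieldType) (I E : finType) (P : {set I})
    (Q : {set E}) (c : I -> E -> K) :
  (#|Q| < #|P|)%N ->
  exists x : I -> K,
    [/\ exists i, x i != 0, forall i, i \notin P -> x i = 0
      & forall e, e \in Q -> \sum_i x i * c i e = 0].
Proof.
move=> ltQP.
pose M : 'M_(#|P|, #|Q|) := \matrix_(a, b) c (enum_val a) (enum_val b).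
pose u := nz_row (kermx M).
have nz_u : u != 0.
  rewrite nz_row_eq0 kermx_eq0 /row_free neq_ltn.
  by rewrite (leq_ltn_trans (rank_leq_col M)).
have uM : u *m M = 0 by apply/eqP; rewrite -sub_kermx nz_row_sub.
exists (fun i => \sum_(a | enum_val a == i) u 0 a); split.
- have [a ua] : exists a, u 0 a != 0 by apply/rV0Pn.
  exists (enum_val a); rewrite (big_pred1 a) // => b.
  exact: (inj_eq enum_val_inj).
- move=> i niP; apply: big_pred0 => a; apply: contraNF niP => /eqP <-.
  exact: enum_valP.
- move=> e eQ; transitivity ((u *m M) 0 (enum_rank_in eQ e)); last first.
    by rewrite uM mxE.
  rewrite mxE.
  transitivity (\sum_i \sum_(a | enum_val a == i) u 0 a * c i e).
    by apply: eq_bigr => i _; rewrite mulr_suml.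
  rewrite (exchange_big_dep predT) //=; apply: eq_bigr => a _.
  rewrite (big_pred1 (enum_val a)) => [|i]; last exact: eq_sym.
  by rewrite mxE enum_rankK_in.
Qed.

(** Dividing by minus the entry of largest modulus. Bounding the absolute values,
rather than only asking for [-1 <= t * c i], keeps both the direction and its
opposite feasible. *)
Lemma exists_scaling (R : realFieldType) (T : finType) (c : T -> R) :
  (exists i, c i != 0) ->
  exists t, (forall i, `|t * c i| <= 1) /\ exists i, t * c i = -1.
Proof.
case=> i0 ci0; case: (arg_maxP (fun i => `|c i|) (isT : predT i0)) => i _ maxi.
have ci : c i != 0.
  by rewrite -normr_gt0 (lt_le_trans _ (maxi i0 isT)) ?normr_gt0.
exists (- (c i)^-1); split=> [k|]; last by exists i; rewrite mulNr mulVf.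
rewrite mulNr normrN normrM normfV mulrC ler_pdivrMr ?normr_gt0 // mul1r.
by apply: maxi.
Qed.

(** Spectral theorem for the 2 x 2 matrix with rows [(a, b)] and [(b, d)]: the
columns of the rotation are [(p, q)] and [(- q, p)]. *)
Lemma diagonalize2 (R : rcfType) (a b d : R) :
  exists p q lam1 lam2 : R,
    [/\ p ^+ 2 + q ^+ 2 = 1,
        a = lam1 * p ^+ 2 + lam2 * q ^+ 2,
        b = (lam1 - lam2) * (p * q)
      & d = lam1 * q ^+ 2 + lam2 * p ^+ 2].
Proof.
have [->|nb] := eqVneq b 0; first by exists 1, 0, a, d; split; ring.
pose s := Num.sqrt ((a - d) ^+ 2 + 4 * b ^+ 2).
have s2 : s ^+ 2 = (a - d) ^+ 2 + 4 * b ^+ 2.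
  by rewrite sqr_sqrtr // addr_ge0 ?sqr_ge0 // mulr_ge0 ?ler0n ?sqr_ge0.
(* The eigenvalues are [a + e] and [d - e]; [(b, e)] is an eigenvector of the
   first one. *)
have [e e2] : exists e, e ^+ 2 = b ^+ 2 + (d - a) * e.
  exists ((d - a + s) / 2).
  have -> : ((d - a + s) / 2) ^+ 2 =
      (s ^+ 2 + 2 * (d - a) * s + (d - a) ^+ 2) / 4 by field.
  by rewrite s2; field.
pose n := Num.sqrt (b ^+ 2 + e ^+ 2).
have n2_gt0 : 0 < b ^+ 2 + e ^+ 2.
  by rewrite ltr_wpDr ?sqr_ge0 // exprn_even_gt0.
have n2 : n ^+ 2 = b ^+ 2 + e ^+ 2 by rewrite sqr_sqrtr // ltW.
have nn : n != 0 by rewrite -sqrf_eq0 n2 gt_eqF.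
exists (b / n), (e / n), (a + e), (d - e); split.
- by rewrite !expr_div_n -mulrDl -n2 divff ?sqrf_eq0.
- apply: (mulIf (_ : n ^+ 2 != 0)); first by rewrite sqrf_eq0.
  have -> : ((a + e) * (b / n) ^+ 2 + (d - e) * (e / n) ^+ 2) * n ^+ 2 =
    (a + e) * b ^+ 2 + (d - e) * e ^+ 2 by field.
  by rewrite n2 !e2; ring: e2.
- apply: (mulIf (_ : n ^+ 2 != 0)); first by rewrite sqrf_eq0.
  have -> : (a + e - (d - e)) * (b / n * (e / n)) * n ^+ 2 =
    b * ((a - d) * e + 2 * e ^+ 2) by field.
  by rewrite n2 e2; ring.
- apply: (mulIf (_ : n ^+ 2 != 0)); first by rewrite sqrf_eq0.
  have -> : ((a + e) * (e / n) ^+ 2 + (d - e) * (b / n) ^+ 2) * n ^+ 2 =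
    (a + e) * e ^+ 2 + (d - e) * b ^+ 2 by field.
  by rewrite n2; ring: e2.
Qed.

(** * Perturbing a Gram sum *)

Definition wgram (R : realType) (l : nat) (J : finType) (lam : J -> R)
    (v : J -> 'cV[R]_l) : 'M[R]_l := \sum_j lam j *: (v j *m (v j)^T).

Lemma wgramE (R : realType) (l : nat) (J : finType) (lam : J -> R)
    (v : J -> 'cV[R]_l) (i k : 'I_l) :
  wgram lam v i k = \sum_j lam j * (v j i 0 * v j k 0).
Proof. by rewrite summxE; apply: eq_bigr => j _; rewrite mxE outerE. Qed.

Lemma wgramZ (R : realType) (l : nat) (J : finType) (t : R) (lam : J -> R)
    (v : J -> 'cV[R]_l) :
  wgram (fun j => t * lam j) v = t *: wgram lam v.
Proof. by rewrite scaler_sumr; apply: eq_bigr => j _; rewrite scalerA. Qed.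

Lemma gram_add_wgram (R : realType) (l : nat) (J : finType) (lam : J -> R)
    (v : J -> 'cV[R]_l) :
  (forall j, -1 <= lam j) ->
  gram v + wgram lam v = gram (fun j => Num.sqrt (1 + lam j) *: v j).
Proof.
move=> lam_ge; rewrite -big_split; apply: eq_bigr => j _ /=.
rewrite linearZ /= -scalemxAl -scalemxAr scalerA -expr2 sqr_sqrtr.
  by rewrite scalerDl scale1r.
by rewrite addrC -lerBlDr sub0r.
Qed.

(** The perturbation acts on the span of [v j1] and [v j2] as a 2 x 2 symmetric
matrix; rotating this pair by the eigenvectors preserves the Gram sum and makes
the perturbation diagonal in the new atoms. *)
Lemma diagonalize_pair (R : realType) (l : nat) (J : finType)
    (v : J -> 'cV[R]_l) (x : J -> R) (b : R) (j1 j2 : J) :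
  j1 != j2 ->
  exists (u : J -> 'cV[R]_l) (lam : J -> R),
    [/\ gram u = gram v,
        wgram lam u =
          wgram x v + b *: (v j1 *m (v j2)^T + v j2 *m (v j1)^T),
        forall j, j != j1 -> j != j2 -> u j = v j /\ lam j = x j,
        exists p q, u j1 = p *: v j1 + q *: v j2 /\
                    u j2 = p *: v j2 - q *: v j1
      & lam j1 = 0 -> lam j2 = 0 -> [/\ x j1 = 0, x j2 = 0 & b = 0]].
Proof.
move=> n12; have n21 : j2 != j1 by rewrite eq_sym.
have [p [q [lam1 [lam2 [pq1 ax bx dx]]]]] := diagonalize2 (x j1) b (x j2).
pose u j := if j == j1 then p *: v j1 + q *: v j2 else
            if j == j2 then p *: v j2 - q *: v j1 else v j.
pose lam j := if j == j1 then lam1 else if j == j2 then lam2 else x j.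
have u1 : u j1 = p *: v j1 + q *: v j2 by rewrite /u eqxx.
have u2 : u j2 = p *: v j2 - q *: v j1 by rewrite /u (negPf n21) eqxx.
have l1 : lam j1 = lam1 by rewrite /lam eqxx.
have l2 : lam j2 = lam2 by rewrite /lam (negPf n21) eqxx.
have rest j : j != j1 -> j != j2 -> u j = v j /\ lam j = x j.
  by rewrite /u /lam => /negPf-> /negPf->.
exists u, lam; split=> //; last 2 first.
- by exists p, q.
- by rewrite l1 l2 ax bx dx => -> ->; split; ring.
- apply/matrixP => i k; rewrite !gramE [LHS](bigD1 j1) //= [RHS](bigD1 j1) //=.
  rewrite [in LHS](bigD1 j2) //= [in RHS](bigD1 j2) //= !addrA; congr (_ + _).
    rewrite u1 u2 !mxE -[RHS]mul1r -pq1; ring.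
  by apply: eq_bigr => j /andP[j_1 j_2]; rewrite (rest _ j_1 j_2).1.
- apply/matrixP => i k; rewrite [RHS]mxE !wgramE [LHS](bigD1 j1) //=.
  rewrite [X in _ = X + _](bigD1 j1) //= [in LHS](bigD1 j2) //=.
  rewrite [in X in _ = X + _](bigD1 j2) //= [RHS]addrC !addrA; congr (_ + _).
    rewrite u1 u2 l1 l2 [in RHS]mxE [in RHS]mxE !outerE ax bx dx !mxE.
    by ring: pq1.
  by apply: eq_bigr => j /andP[j_1 j_2]; have [-> ->] := rest _ j_1 j_2.
Qed.

(** Rescaling a slack by a nonnegative factor preserves its sign, which is all
that the constraint depends on, whichever the relation. *)
Lemma constr_holds_shrink (R : realType) (c : constr_rel) (x x' d t : R) :
  0 <= t -> d - x' = t * (d - x) -> constr_holds c x d -> constr_holds c x' d.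
Proof.
move=> t0 eqd; case: c => /= h.
- by rewrite -subr_ge0 eqd mulr_ge0 ?subr_ge0.
- by apply/eqP; rewrite eq_sym -subr_eq0 eqd h subrr mulr0.
- by rewrite -subr_le0 eqd mulr_ge0_le0 ?subr_le0.
Qed.

(** A relative change by at least -1 keeps the atom weights [1 + lam j] and the
slack factors [1 + y k] nonnegative. At a position of [D] with [U i i <= 0], the
entry of [gram u], a sum of squares, forces every atom to vanish there, so the
perturbation vanishes too: this is why the equations on [Z] range over the
positive entries. *)
Lemma feasible_add_wgram (R : realType) (l m : nat)
    (A : 'I_m.+1 -> 'M[R]_l) (rels : 'I_m -> constr_rel) (delta : 'I_m -> R)
    (D : {set 'I_l * 'I_l}) (U : 'M[R]_l) (J : finType)
    (u : J -> 'cV[R]_l) (lam : J -> R) (y : 'I_m -> R) :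
  sdp_feasible A rels delta D U (gram u) ->
  (forall j, -1 <= lam j) -> (forall k, -1 <= y k) ->
  (forall k, mxdot (A (lift ord0 k)) (wgram lam u) =
             - (y k * (delta k - mxdot (A (lift ord0 k)) (gram u)))) ->
  (forall i, (i, i) \in D -> 0 < U i i -> wgram lam u i i = 0) ->
  sdp_feasible A rels delta D U (gram u + wgram lam u).
Proof.
case=> _ hk hd lam_ge y_ge eqk eqd; split=> [|k|i iD].
- by rewrite gram_add_wgram //; apply: psd_gram.
- apply: (@constr_holds_shrink _ _ _ _ _ (1 + y k)) (hk k).
    by rewrite addrC -lerBlDr sub0r.
  by rewrite mxdotDr eqk; ring.
- rewrite mxE (hd i iD).
  have [Upos|Uneg] := ltP 0 (U i i); first by rewrite eqd ?addr0.
  have Y0 : \sum_j u j i 0 * u j i 0 = 0.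
    apply/eqP; rewrite eq_le sumr_ge0 => [|j _]; last exact: sqr_ge0.
    by rewrite -gramE (hd i iD) Uneg.
  rewrite wgramE big1 ?addr0 // => j _.
  have /eqP := Y0; rewrite psumr_eq0 => [|k _]; last exact: sqr_ge0.
  by move=> /allP/(_ j (mem_index_enum j))/= /eqP ->; rewrite mulr0.
Qed.

(** * The semidefinite program and its separable form *)

Section BlockProgram.

Variables (R : realType) (l m qh : nat) (F : 'I_qh -> {set 'I_l}).
Variables (A : 'I_m.+1 -> 'M[R]_l) (B : 'I_m.+1 -> forall q, 'M[R]_#|F q|).
Variables (rels : 'I_m -> constr_rel) (delta : 'I_m -> R).
Variables (D : {set 'I_l * 'I_l}) (U : 'M[R]_l).
Hypothesis hF : ordered_partition F.
Hypothesis hAB : forall k, A k = block_diag (B k).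

Lemma block_exists (i : 'I_l) : exists q, i \in F q.
Proof.
case: hF => _ /and3P[/eqP covF _ _] _.
have : i \in cover [set F q | q : 'I_qh] by rewrite covF inE.
by case/bigcupP => _ /imsetP[q _ ->] iq; exists q.
Qed.

Lemma block_unique (i : 'I_l) (q r : 'I_qh) : i \in F q -> i \in F r -> q = r.
Proof.
case: hF => Finj /and3P[_ /trivIsetP tF _] _ iq; apply: contraTeq => neq.
have /disjointFr/(_ iq) -> // : [disjoint F q & F r].
by apply: tF; rewrite ?imset_f // (inj_eq Finj).
Qed.

Lemma mxdot_blocks k Y : mxdot (A k) Y = sep_dot (B k) (blocks F Y).
Proof. by rewrite hAB mxdot_block_diag. Qed.

Lemma sep_feasible_ext (W W' : forall q, 'M[R]_#|F q|) :
  (forall q, W q = W' q) ->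
  sep_feasible B rels delta D U W -> sep_feasible B rels delta D U W'.
Proof.
move=> eqW [psdW hk hd]; split=> [q|k|q a aD].
- by rewrite -eqW.
- suff <- : sep_dot (B (lift ord0 k)) W = sep_dot (B (lift ord0 k)) W' by [].
  by apply: eq_bigr => q _; rewrite eqW.
- by rewrite -eqW hd.
Qed.

Lemma sdp_feasible_blocks Y :
  psd Y ->
  sdp_feasible A rels delta D U Y <->
  sep_feasible B rels delta D U (blocks F Y).
Proof.
move=> psdY; split=> -[_ hk hd]; split=> //.
- by move=> q; apply: psd_blocks.
- by move=> k; rewrite -mxdot_blocks.
- by move=> q a; rewrite inE => /andP[aD _]; rewrite mxE hd.
- by move=> k; rewrite mxdot_blocks.
- move=> i iD; have [q iq] := block_exists i.
  have := hd q (enum_rank_in iq i).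
  by rewrite mxE enum_rankK_in // !inE iD iq; apply.
Qed.

Lemma sep_optimal_blocks Y :
  sdp_optimal A rels delta D U Y -> sep_optimal B rels delta D U (blocks F Y).
Proof.
case=> fY minY; have psdY : psd Y by case: fY.
split=> [|W fW]; first exact/sdp_feasible_blocks.
have psdW : psd (block_diag W) by apply: psd_block_diag; case: fW.
have eqW q : blocks F (block_diag W) q = W q by apply: blocks_block_diag.
have -> : sep_dot (B ord0) W = sep_dot (B ord0) (blocks F (block_diag W)).
  by apply: eq_bigr => q _; rewrite eqW.
rewrite -!mxdot_blocks; apply/minY/sdp_feasible_blocks => //.
by apply: sep_feasible_ext fW => q; rewrite eqW.
Qed.

(** Entries outside the blocks only matter for positive semidefiniteness. This
serves to pass to the block-diagonal part of a solution and, at the end, to fill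
in the off-diagonal blocks so as to get rank one. *)
Lemma sdp_optimal_blocks_ext Y Y' :
  psd Y' -> (forall q, blocks F Y q = blocks F Y' q) ->
  sdp_optimal A rels delta D U Y -> sdp_optimal A rels delta D U Y'.
Proof.
move=> psdY' eqY [fY minY]; have psdY : psd Y by case: fY.
split=> [|Z /minY].
  apply/sdp_feasible_blocks => //; apply: sep_feasible_ext eqY _.
  exact/sdp_feasible_blocks.
suff -> : mxdot (A ord0) Y = mxdot (A ord0) Y' by [].
by rewrite !mxdot_blocks; apply: eq_bigr => q _; rewrite eqY.
Qed.

(** * Reducing the number of active atoms and slacks *)

Definition slack (Y : 'M[R]_l) (k : 'I_m) : R :=
  delta k - mxdot (A (lift ord0 k)) Y.

Definition supported (J : finType) (lab : J -> 'I_qh) (v : J -> 'cV[R]_l) :=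
  forall j i, i \notin F (lab j) -> v j i 0 = 0.

(** The quantity minimized is the size of this set. Zero atoms stay in the family
without being counted, so the index type [J] never changes. *)
Definition active (J : finType) (v : J -> 'cV[R]_l) : {set J + 'I_m} :=
  [set e | match e with
           | inl j => v j != 0
           | inr k => slack (gram v) k != 0
           end].

(** Each nonzero block contains a nonzero atom, and the block of [j1] and [j2]
contains two of them: even without [j2] every nonzero block keeps an atom. *)
Lemma active_count (J : finType) (lab : J -> 'I_qh) (v : J -> 'cV[R]_l)
    (j1 j2 : J) :
  supported lab v -> j1 != j2 -> lab j1 = lab j2 ->
  v j1 != 0 -> v j2 != 0 ->
  (num_nonzero B delta (blocks F (gram v)) < #|active v|)%N.
Proof.
move=> supv n12 l12 v1 v2.
pose S := [set inl j | j : J & v j != 0] : {set J + 'I_m}.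
pose T := [set inr k | k : 'I_m & slack (gram v) k != 0] : {set J + 'I_m}.
have -> : active v = S :|: T.
  apply/setP => -[j|k]; rewrite !inE.
    rewrite (mem_imset _ _ (@inl_inj _ _)) inE.
    by case: imsetP => [[? _]|] //; rewrite orbF.
  rewrite (mem_imset _ _ (@inr_inj _ _)) inE.
  by case: imsetP => [[? _]|].
have -> : #|S :|: T| = (#|S| + #|T|)%N.
  rewrite cardsU (_ : S :&: T = set0) ?cards0 ?subn0 //.
  by apply/setP => e; rewrite !inE; apply/andP => -[/imsetP[? _ ->] /imsetP[]].
rewrite -addSn leq_add //; last first.
  rewrite card_imset; last exact: inr_inj.
  apply/subset_leq_card/subsetP => k; rewrite !inE /slack mxdot_blocks.
  by [].
rewrite card_imset; last exact: inl_inj.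
rewrite (cardsD1 j2) inE v2 add1n ltnS.
apply: leq_trans (leq_imset_card lab _).
apply/subset_leq_card/subsetP => q; rewrite inE => Wq.
suff [j lj vj] : exists2 j, lab j = q & v j != 0.
  have [ej|nj] := eqVneq j j2.
    by apply/imsetP; exists j1; rewrite ?inE ?n12 // l12 -ej.
  by apply/imsetP; exists j; rewrite ?inE ?nj.
have [j /andP[/eqP lj vj] | no] := pickP [pred j | (lab j == q) && (v j != 0)].
  by exists j.
case/eqP: Wq; apply/matrixP => a b; rewrite !mxE gramE big1 // => j _.
have [lj|nl] := eqVneq (lab j) q.
  by have := no j; rewrite /= lj eqxx => /negbFE/eqP ->; rewrite mxE mul0r.
rewrite supv ?mul0r //; apply: contra nl => aj; apply/eqP.
exact: block_unique aj (enum_valP a).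
Qed.

(** The heart of the proof: with two active atoms in one block there are more
parameters than equations, and following a solution to the boundary in a
direction orthogonal to the objective deactivates an atom or a slack. *)
Lemma exists_fewer_active (J : finType) (lab : J -> 'I_qh) (v : J -> 'cV[R]_l)
    (j1 j2 : J) :
  (forall W, sep_optimal B rels delta D U W ->
     (m + num_pos_diag D U - 1 <= num_nonzero B delta W)%N) ->
  supported lab v -> sdp_optimal A rels delta D U (gram v) ->
  j1 != j2 -> lab j1 = lab j2 -> v j1 != 0 -> v j2 != 0 ->
  exists w : J -> 'cV[R]_l,
    [/\ supported lab w, sdp_optimal A rels delta D U (gram w)
      & (#|active w| < #|active v|)%N].
Proof.
move=> hW supv optv n12 l12 v1 v2.
have many : (m + num_pos_diag D U < #|active v|.+1)%N.
  have lt_act := active_count supv n12 l12 v1 v2.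
  have := hW _ (sep_optimal_blocks optv); rewrite leq_subLR add1n ltnS.
  by move/leq_trans; apply.
(* Unknowns: weights of atoms, relative changes of slacks, and, as [inr tt],
   the coefficient of the mixed term [v j1 (v j2)^T + v j2 (v j1)^T]. *)
pose P : {set (J + 'I_m) + unit} := inr tt |: (inl @: active v).
have inlP e : (inl e \in P) = (e \in active v).
  by rewrite in_setU1 (mem_imset _ _ (@inl_inj _ _)).
have cardP : #|P| = #|active v|.+1.
  rewrite cardsU1 card_imset; last exact: inl_inj.
  by case: imsetP => [[]|].
(* Equations: all the slacks, and the positive prescribed diagonal entries. *)
pose Q : {set 'I_m + 'I_l} :=
  [set inl k | k : 'I_m]
  :|: [set inr i | i : 'I_l & ((i, i) \in D) && (0 < U i i)].
have cardQ : (#|Q| <= m + num_pos_diag D U)%N.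
  apply: leq_trans (leq_card_setU _ _) _; rewrite leq_add //.
    by apply: leq_trans (leq_imset_card _ _) _; rewrite card_ord.
  apply: leq_trans (leq_imset_card _ _) _.
  rewrite -(card_imset _ (_ : injective (fun i : 'I_l => (i, i)))); last first.
    by move=> i k [].
  apply/subset_leq_card/subsetP => p /imsetP[i]; rewrite inE => iDU ->.
  by rewrite inE.
pose M (e : (J + 'I_m) + unit) : 'M[R]_l := match e with
  | inl (inl j) => v j *m (v j)^T
  | inl (inr k) => 0
  | inr _ => v j1 *m (v j2)^T + v j2 *m (v j1)^T end.
pose c e (f : 'I_m + 'I_l) : R := match f with
  | inl k => mxdot (A (lift ord0 k)) (M e) +
             (if e == inl (inr k) then slack (gram v) k else 0)
  | inr i => M e i i end.
have [|x [nzx suppx kerx]] := @exists_kernel R _ _ P Q c.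
  by rewrite cardP (leq_ltn_trans cardQ).
pose xJ j := x (inl (inl j)); pose y k := x (inl (inr k)); pose b := x (inr tt).
have sumM : \sum_e x e *: M e =
    wgram xJ v + b *: (v j1 *m (v j2)^T + v j2 *m (v j1)^T).
  rewrite !big_sumType /= -addrA; congr (_ + _).
  rewrite big1 => [|k _]; last by rewrite scaler0.
  by rewrite add0r (big_pred1 tt) // => -[].
have [u [lam [gu wu rest [p [q [u1 u2]]] lam0]]] := diagonalize_pair v xJ b n12.
have supu : supported lab u.
  move=> j i ij; have [e1|n1] := eqVneq j j1.
    by rewrite e1 in ij *; rewrite u1 !mxE supv // supv -?l12 // !mulr0 addr0.
  have [e2|n2] := eqVneq j j2; last by rewrite (rest j n1 n2).1 supv.
  by rewrite e2 in ij *; rewrite u2 !mxE supv // supv ?l12 // !mulr0 subr0.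
have actu e : e \in active u -> e \in active v.
  case: e => [j|k]; rewrite !inE ?gu //.
  have [->|n1] := eqVneq j j1; first by rewrite v1.
  have [->|n2] := eqVneq j j2; first by rewrite v2.
  by rewrite (rest j n1 n2).1.
have eq_constr k :
    mxdot (A (lift ord0 k)) (wgram lam u) = - (y k * slack (gram v) k).
  have kQ : inl k \in Q by rewrite inE imset_f.
  apply/eqP; rewrite -subr_eq0 opprK wu -sumM mxdot_sumr; apply/eqP.
  rewrite -[RHS](kerx _ kQ); under [RHS]eq_bigr do rewrite /= mulrDr.
  rewrite big_split /=; congr (_ + _).
    by apply: eq_bigr => e _; rewrite mxdotZr.
  rewrite (bigD1 (inl (inr k))) //= eqxx big1 ?addr0 // => e /negPf ->.
  by rewrite mulr0.
have eq_diag i : (i, i) \in D -> 0 < U i i -> wgram lam u i i = 0.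
  move=> iD Ui; have iQ : inr i \in Q.
    by rewrite inE orbC imset_f // inE iD.
  rewrite -[RHS](kerx _ iQ) wu -sumM summxE.
  by apply: eq_bigr => e _; rewrite mxE.
(* After diagonalization the direction is a relative change [d] of the atoms and
   the slacks, and it only involves active ones. *)
pose d (e : J + 'I_m) := match e with inl j => lam j | inr k => y k end.
have suppd e : d e != 0 -> e \in active v.
  case: e => [j|k] /=.
    have [->|n1] := eqVneq j j1; first by rewrite inE v1.
    have [->|n2] := eqVneq j j2; first by rewrite inE v2.
    rewrite (rest j n1 n2).2; apply: contraNT => nj.
    by apply/eqP/suppx; rewrite inlP.
  by apply: contraNT => nk; apply/eqP/suppx; rewrite inlP.
(* The direction is still nonzero: if both new weights of the rotated pair
   vanish, so do the old ones and the mixed coefficient. *)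
have nzd : exists e, d e != 0.
  have [e de | d0] := pickP [pred e | d e != 0]; first by exists e.
  have dz e : d e = 0 by have := d0 e => /negbFE/eqP.
  have [x1 x2 b0] := lam0 (dz (inl j1)) (dz (inl j2)).
  case: nzx => -[[j|k]|[]] /eqP[] //; last exact: (dz (inr k)).
  have [->//|n1] := eqVneq j j1; have [->//|n2] := eqVneq j j2.
  by rewrite -/(xJ j) -(rest j n1 n2).2; apply: (dz (inl j)).
have [t [t_le [e0 te0]]] := exists_scaling nzd.
(* The sign [s] is 1 or -1: both [Y + t Z] and [Y - t Z] are feasible. *)
have feas (s : R) : `|s| = 1 ->
    sdp_feasible A rels delta D U (gram u + (s * t) *: wgram lam u).
  move=> s1; have bnd e : -1 <= s * t * d e.
    have := t_le e; rewrite -[`|_|]mul1r -s1 -normrM mulrA.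
    by rewrite ler_norml => /andP[].
  rewrite -wgramZ; apply: (feasible_add_wgram (y := fun k => s * t * y k)).
  - by rewrite gu; case: optv.
  - by move=> j; apply: (bnd (inl j)).
  - by move=> k; apply: (bnd (inr k)).
  - by move=> k; rewrite wgramZ mxdotZr eq_constr gu mulrN mulrA.
  - by move=> i iD Ui; rewrite wgramZ mxE eq_diag ?mulr0.
have obj0 : t * mxdot (A ord0) (wgram lam u) = 0.
  case: optv => _ minv.
  have := minv _ (feas 1 (normr1 _)); have := minv _ (feas (-1) (normrN1 _)).
  by rewrite !mxdotDr !mxdotZr gu; lra.
have bnd e : -1 <= t * d e by have := t_le e; rewrite ler_norml => /andP[].
pose w j := Num.sqrt (1 + t * lam j) *: u j.
have gw : gram w = gram u + t *: wgram lam u.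
  by rewrite -wgramZ gram_add_wgram // => j; apply: (bnd (inl j)).
have slackw k : slack (gram w) k = (1 + t * y k) * slack (gram v) k.
  by rewrite /slack gw mxdotDr mxdotZr eq_constr gu /slack; ring.
exists w; split.
- by move=> j i ij; rewrite mxE supu ?mulr0.
- rewrite gw; split; first by have := feas 1 (normr1 _); rewrite mul1r.
  by move=> Y fY; rewrite mxdotDr mxdotZr obj0 addr0 gu; apply: (optv.2).
- apply/proper_card/properP; split; last first.
    exists e0.
      apply: suppd; apply: contra_eq_neq te0 => ->.
      by rewrite mulr0 eq_sym oppr_eq0 oner_eq0.
    case: e0 te0 => [j|k] /= te0; rewrite inE negbK ?slackw /w te0 subrr.
      by rewrite sqrtr0 scale0r.
    by rewrite mul0r.
  apply/subsetP => -[j|k]; rewrite inE.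
    by rewrite /w scaler_eq0 => /norP[_ uj]; apply: actu; rewrite inE.
  by rewrite slackw mulf_eq0 => /norP[_ sk]; rewrite inE.
Qed.

(** * Passing from block atoms to rank one *)

(** The atoms of a factorization of [Y] are cut along the blocks; only the
off-diagonal blocks of [Y] are lost. *)
Lemma split_atoms Y :
  psd Y -> exists N (v : 'I_qh * 'I_N -> 'cV[R]_l),
    supported fst v /\ forall q, blocks F Y q = blocks F (gram v) q.
Proof.
case/psd_gramP=> N [u ->].
pose v (j : 'I_qh * 'I_N) : 'cV[R]_l :=
  \col_i (if i \in F j.1 then u j.2 i 0 else 0).
exists N, v; split=> [[q n] i /negPf ij | q]; first by rewrite mxE /= ij.
apply/matrixP => a b; rewrite !mxE !gramE.
rewrite -(pair_bigA _ (fun r n =>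
  v (r, n) (enum_val a) 0 * v (r, n) (enum_val b) 0)) /=.
rewrite (bigD1 q) //= [X in _ + X]big1 ?addr0 => [|r nrq].
  by apply: eq_bigr => n _; rewrite !mxE /= !enum_valP.
apply: big1 => n _; rewrite !mxE /= ifN ?mul0r //.
by apply: contra nrq => ar; rewrite (block_unique ar (enum_valP a)).
Qed.

(** In a block with one nonzero atom [v j], all the other atoms vanish on the
block, so the sum of the atoms coincides there with [v j]. *)
Lemma merge_atoms (J : finType) (lab : J -> 'I_qh) (v : J -> 'cV[R]_l)
    (q : 'I_qh) :
  supported lab v ->
  (forall j1 j2, j1 != j2 -> lab j1 = lab j2 -> v j1 != 0 -> v j2 = 0) ->
  blocks F (gram v) q = blocks F ((\sum_j v j) *m (\sum_j v j)^T) q.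
Proof.
move=> supv one; apply/matrixP => a b.
rewrite [LHS]mxE [RHS]mxE outerE gramE !summxE.
have off j c : lab j != q -> v j (enum_val (c : 'I_#|F q|)) 0 = 0.
  move=> nl; apply: supv; apply: contra nl => cj; apply/eqP.
  exact: block_unique cj (enum_valP c).
have [j0 /andP[/eqP l0 v0] | no] := pickP [pred j | (lab j == q) && (v j != 0)].
  have others j c : j != j0 -> v j (enum_val (c : 'I_#|F q|)) 0 = 0.
    move=> nj; have [lj|nl] := eqVneq (lab j) q; last exact: off.
    by rewrite (one j0 j) ?mxE // 1?eq_sym // l0.
  have sum0 c : \sum_j v j (enum_val (c : 'I_#|F q|)) 0 = v j0 (enum_val c) 0.
    by rewrite (bigD1 j0) //= big1 ?addr0 // => j; apply: others.
  rewrite !sum0 (bigD1 j0) //= big1 ?addr0 // => j nj.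
  by rewrite others ?mul0r.
have zero j c : v j (enum_val (c : 'I_#|F q|)) 0 = 0.
  have [lj|nl] := eqVneq (lab j) q; last exact: off.
  by have := no j; rewrite /= lj eqxx => /negbFE/eqP ->; rewrite mxE.
rewrite big1 => [|j _]; last by rewrite zero mul0r.
by rewrite [X in X * _]big1 ?mul0r.
Qed.

Lemma rank1_optimal (J : finType) (lab : J -> 'I_qh) (v : J -> 'cV[R]_l) :
  (forall W, sep_optimal B rels delta D U W ->
     (m + num_pos_diag D U - 1 <= num_nonzero B delta W)%N) ->
  supported lab v -> sdp_optimal A rels delta D U (gram v) ->
  exists2 Y, sdp_optimal A rels delta D U Y & (\rank Y <= 1)%N.
Proof.
move=> hW; have [d] := ubnP #|active v|.
elim: d v => // d IH v ltd supv optv.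
pose bad (j : J * J) :=
  [&& j.1 != j.2, lab j.1 == lab j.2, v j.1 != 0 & v j.2 != 0].
have [[j1 j2] /and4P[/= n12 /eqP l12 v1 v2] | good] := pickP bad.
  have [w [supw optw ltw]] := exists_fewer_active hW supv optv n12 l12 v1 v2.
  by apply: IH supw optw; apply: leq_trans ltw _.
pose w := \sum_j v j; exists (w *m w^T); last exact: mulmx_max_rank.
have psdw : psd (w *m w^T).
  by have := psd_gram (fun _ : unit => w); rewrite /gram (big_pred1 tt) // => -[].
apply: sdp_optimal_blocks_ext psdw _ optv => q.
apply: (merge_atoms q supv) => j1 j2 n12 l12 v1; apply/eqP.
by have := good (j1, j2); rewrite /bad /= n12 l12 eqxx v1 => /negbFE.
Qed.

End BlockProgram.

(** * Exactness *)

Theorem theorem4p4 (R : realType) (l m : nat)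
    (A : 'I_m.+1 -> 'M[R]_l) (rels : 'I_m -> constr_rel)
    (D : {set 'I_l * 'I_l}) (delta : 'I_m -> R) (U : 'M[R]_l)
    (hA : forall k, A k \is symmetricmx)
    (hD : forall p, p \in D -> p.1 = p.2)
    (qh : nat) (F : 'I_qh -> {set 'I_l}) (hF : ordered_partition F)
    (B : 'I_m.+1 -> forall q : 'I_qh, 'M[R]_#|F q|)
    (hB : forall k q, B k q \is symmetricmx)
    (hAB : forall k, A k = block_diag (B k))
    (hW : forall W : forall q : 'I_qh, 'M[R]_#|F q|,
       sep_optimal B rels delta D U W ->
       (m + num_pos_diag D U - 1 <= num_nonzero B delta W)%N) :
  sdp_exact A rels delta D U.
Proof.
case=> Y optY; have psdY : psd Y by case: optY => -[].
have [N [v [supv eqv]]] := split_atoms hF psdY.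
apply: (rank1_optimal hF hAB hW supv).
exact: (sdp_optimal_blocks_ext hF hAB (psd_gram v) eqv optY).
Qed.
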